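(* Let $P$ be the transition matrix of a finite irreducible Markov chain with states $\{1,\dots,m\}$, and let $\bar P=P+\mathcal{E}$ be the transition matrix of a perturbed Markov chain, also irreducible, where $\mathcal{E}=[\varepsilon_{ij}]$ is the matrix of perturbations (so $\sum_{j=1}^m\varepsilon_{ij}=0$ for each $i$). Let $\boldsymbol{\pi}^T=(\pi_1,\dots,\pi_m)$ and $\bar{\boldsymbol{\pi}}^T=(\bar\pi_1,\dots,\bar\pi_m)$ be the stationary probability vectors of $P$ and $\bar P$, respectively. Let $G=[g_{ij}]$ be any g-inverse of $I-P$, $g_{k\bullet}=\sum_{j=1}^m g_{kj}$, $H=[h_{ij}]=G(I-\Pi)$ with $\Pi=\boldsymbol{e}\boldsymbol{\pi}^T$, let $M=[m_{ij}]$ be the mean first passage time matrix of the chain with transition matrix $P$, and let $N=[n_{ij}]=(M-M_d)(M_d)^{-1}$. Then for all $j=1,\dots,m$: (i) $\bar\pi_j-\pi_j=\sum_{i=1}^m\sum_{k=1}^m\bar\pi_i\varepsilon_{ik}h_{kj}$. (ii) $\bar\pi_j-\pi_j=\sum_{i=1}^m\sum_{k=1}^m\bar\pi_i\varepsilon_{ik}g_{kj}-\pi_j\sum_{i=1}^m\sum_{k=1}^m\bar\pi_i\varepsilon_{ik}g_{k\bullet}$. (iii) If $G\in A\{1,5a\}$, i.e. $G=G(\boldsymbol{e},\boldsymbol{\beta},\gamma)$, then $\bar\pi_j-\pi_j=\sum_{i=1}^m\sum_{k=1}^m\bar\pi_i\varepsilon_{ik}g_{kj}$. (iv) For all perturbations,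 $\pi_j-\bar\pi_j=\pi_j\sum_{i=1}^m\sum_{k\neq j}\bar\pi_i\varepsilon_{ik}m_{kj}$. (v) For all perturbations, $\pi_j-\bar\pi_j=\sum_{l\neq j}\sum_{k=1}^m\bar\pi_k\varepsilon_{kl}n_{lj}$.
   Context: $\boldsymbol{e}$ is the all-ones column vector; the stationary probability vector of $P$ satisfies $\boldsymbol{\pi}^TP=\boldsymbol{\pi}^T$, $\boldsymbol{\pi}^T\boldsymbol{e}=1$. $m_{ij}=E[T_{ij}\mid X_0=i]$, where $T_{ij}=\min\{n\ge 1: X_n=j\}$ given $X_0=i$ (first return when $i=j$); these are finite and $m_{jj}=1/\pi_j$. For a square matrix $X$, $X_d$ is the diagonal matrix with the same diagonal as $X$; thus $n_{ij}=(1-\delta_{ij})\pi_jm_{ij}$ with $\delta_{ij}$ the Kronecker delta. A g-inverse of $I-P$ is a real $m\times m$ matrix $G$ with $(I-P)G(I-P)=I-P$. Parametric form (known fact): every g-inverse $G$ of $I-P$ can be uniquely written as $G=[I-P+\boldsymbol{\alpha}\boldsymbol{\beta}^T]^{-1}+\gamma\boldsymbol{e}\boldsymbol{\pi}^T$ with $\boldsymbol{\alpha},\boldsymbol{\beta}\in\mathbb{R}^m$, $\gamma\in\mathbb{R}$, $\boldsymbol{\pi}^T\boldsymbol{\alpha}=1$, $\boldsymbol{\beta}^T\boldsymbol{e}=1$; this is written $G=G(\boldsymbol{\alpha},\boldsymbol{\beta},\gamma)$. By definition $G\in A\{1,5a\}$ iff $\boldsymbol{\alpha}=\boldsymbol{e}$.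 *)

(* Defs.v *)
(* MathComp / MathComp-Analysis *)
From mathcomp Require Import all_boot all_order all_algebra.
From mathcomp Require Import all_classical all_reals all_analysis.

Set Implicit Arguments.
Unset Strict Implicit.
Unset Printing Implicit Defensive.

Import Order.TTheory GRing.Theory Num.Theory.
Import numFieldNormedType.Exports.

Local Open Scope classical_set_scope.
Local Open Scope ring_scope.

Definition ones (R : realType) (m : nat) : 'cV[R]_m := const_mx 1.
Arguments ones {R m}.

Definition stochastic (R : realType) (m : nat) (P : 'M[R]_m) : Prop :=
  (forall i j, 0 <= P i j) /\ (forall i, \sum_(j < m) P i j = 1).

Definition irreducible_chain (R : realType) (m : nat) (P : 'M[R]_m) : Prop :=
  forall i j, exists n : nat, 0 < (P ^+ n) i j.

Definition stationary (R : realType) (m : nat) (P : 'M[R]_m) (pi : 'cV[R]_m)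
    : Prop :=
  [/\ forall i, 0 <= pi i 0, pi^T *m P = pi^T & pi^T *m ones = 1%:M].

(* The time-homogeneous Markov property is written multiplicatively:
   Pr(X_0 = x_0, .., X_(n+1) = x_(n+1))
     = Pr(X_0 = x_0, .., X_n = x_n) * P(x_n, x_(n+1)),
   so that no condition Pr(X_0 = x_0, .., X_n = x_n) > 0 is needed; only the
   first n.+2 values of x matter. *)
Definition markov_chain_from (R : realType) (m : nat) (P : 'M[R]_m) (i : 'I_m)
    (d : measure_display) (Omega : measurableType d)
    (Pr : probability Omega R) (X : nat -> Omega -> 'I_m) : Prop :=
  [/\ forall n s, measurable [set w | X n w = s],
      Pr [set w | X 0%N w = i] = 1%E &
      forall (n : nat) (x : nat -> 'I_m),
        Pr [set w | forall k, (k <= n.+1)%N -> X k w = x k] =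
        (Pr [set w | forall k, (k <= n)%N -> X k w = x k]
         * (P (x n) (x n.+1))%:E)%E].

(* min {n >= 1 : X_n = j}, with value +oo when j is never reached. *)
Definition passage_time (R : realType) (m : nat) (Omega : Type)
    (X : nat -> Omega -> 'I_m) (j : 'I_m) (w : Omega) : \bar R :=
  ereal_inf [set (n%:R)%:E | n in [set n : nat | (0 < n)%N /\ X n w = j]].

(* Pr i is the law of the chain started at i, so the (i, j) entry is
   E[T_ij | X_0 = i]; [fine] only serves to land in R, these expectations being
   finite for a finite irreducible chain. *)
Definition mean_passage (R : realType) (m : nat)
    (d : measure_display) (Omega : measurableType d)
    (Pr : 'I_m -> probability Omega R) (X : nat -> Omega -> 'I_m) : 'M[R]_m :=
  \matrix_(i < m, j < m) fine (\int[Pr i]_w passage_time R X j w)%E.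

Definition diag_part (R : realType) (m : nat) (A : 'M[R]_m) : 'M[R]_m :=
  diag_mx (\row_i A i i).

Definition ginverse (R : realType) (m : nat) (A G : 'M[R]_m) : Prop :=
  A *m G *m A = A.

(* G = G(alpha, beta, gamma). The two normalizations make
   I - P + alpha beta^T invertible when P is stochastic and irreducible with
   stationary vector pi, so [invmx] is a genuine inverse. *)
Definition ginverse_param (R : realType) (m : nat) (P : 'M[R]_m)
    (pi : 'cV[R]_m) (G : 'M[R]_m) (alpha beta : 'cV[R]_m) (gamma : R) : Prop :=
  [/\ pi^T *m alpha = 1%:M, beta^T *m ones = 1%:M &
      G = invmx (1%:M - P + alpha *m beta^T) + gamma *: (ones *m pi^T)].

Definition in_A15a (R : realType) (m : nat) (P : 'M[R]_m) (pi : 'cV[R]_m)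
    (G : 'M[R]_m) : Prop :=
  ginverse (1%:M - P) G /\
  exists (beta : 'cV[R]_m) (gamma : R), ginverse_param P pi G ones beta gamma.

(* Main.v *)
Require Import Defs.
From mathcomp Require Import all_boot all_order all_algebra.
From mathcomp Require Import all_classical all_reals all_analysis.
Import Order.TTheory GRing.Theory Num.Theory.
Local Open Scope ring_scope.

(* Let [Q] be [P] with column [j] replaced by [0]. Positivity of [pi] makes
   [I - Q] invertible; this gives both the uniqueness of the stationary vector
   and the boundedness of the sums of [Q^n e]. As [Q^n e] at [i] is the
   probability that the chain started at [i] avoids [j] at times [1 .. n],
   column [j] of [M] is the sum of all [Q^n e], hence it is a finite solution
   [c] of [c = e + Q c]. Since [pibar^T E = pibar^T (I - P)], parts (i)-(iii)
   follow from [(I - P) G (I - Pi) = I - Pi], and parts (iv)-(v) from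
   [(I - P) c = e - c_j P e_j]. *)

Set Implicit Arguments.
Unset Strict Implicit.

(** * Taboo matrix and matrix preliminaries *)

Definition taboo (R : realType) (m : nat) (P : 'M[R]_m) (j : 'I_m) : 'M[R]_m :=
  \matrix_(i, k) (P i k *+ (k != j)).

(** Clearing column [j] is the rank-one correction [P - P e_j e_j^T]. Row [j] is kept, so a chain
    started at [j], and its first return, are covered too. *)
Lemma taboo_mulmx (R : realType) m n (P : 'M[R]_m) j (A : 'M[R]_(m, n)) :
  taboo P j *m A = P *m A - col j P *m row j A.
Proof.
apply/matrixP => i k; rewrite !mxE big_ord1 !mxE (bigD1 j) //=.
rewrite !mxE eqxx mulr0n mul0r add0r [in RHS](bigD1 j) //= addrAC subrr add0r.
by apply: eq_bigr => l /negbTE lj; rewrite !mxE lj mulr1n.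
Qed.

Lemma stochastic_mul_ones (R : realType) m (P : 'M[R]_m) :
  stochastic P -> P *m ones = ones.
Proof.
case=> _ P1; apply/colP => i; rewrite !mxE -[RHS](P1 i).
by apply: eq_bigr => k _; rewrite mxE mulr1.
Qed.

Lemma expmx_ge0 (R : realType) m (P : 'M[R]_m) n :
  (forall i k, 0 <= P i k) -> forall i k, 0 <= (P ^+ n) i k.
Proof.
move=> P0; elim: n => [|n IH] i k; first by rewrite expr0 mxE ler0n.
by rewrite exprS -mulmxE mxE sumr_ge0 // => l _; rewrite mulr_ge0.
Qed.

Lemma unitmx_col_inj (F : fieldType) m (A : 'M[F]_m) :
  (forall x : 'cV[F]_m, A *m x = 0 -> x = 0) -> A \in unitmx.
Proof.
move=> Ainj; rewrite -unitmx_tr -row_free_unit -kermx_eq0.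
apply/rowV0P => v /sub_kermxP vA; apply: trmx_inj; rewrite trmx0.
by apply: Ainj; apply: trmx_inj; rewrite trmx_mul trmxK vA trmx0.
Qed.

(** * Positivity of the stationary vector and the left kernel of [I - P] *)

Section Chain.
Context (R : realType) (m : nat) (P : 'M[R]_m) (pi : 'cV[R]_m).
Hypotheses (P_stoch : stochastic P) (P_irr : irreducible_chain P).
Hypothesis pi_stat : stationary P pi.

Let P_ge0 i k : 0 <= P i k. Proof. by case: P_stoch. Qed.

Lemma stationary_expmx n : pi^T *m P ^+ n = pi^T.
Proof.
elim: n => [|n IH]; first by rewrite expr0 mulmx1.
by rewrite exprS -mulmxE mulmxA; case: pi_stat => _ -> _.
Qed.

(** Some [pi_i] is positive because the entries sum to 1, and [pi_j = (pi^T P^n)_j] contains the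
    term [pi_i (P^n)_ij]. *)
Lemma stationary_gt0 j : 0 < pi j 0.
Proof.
case: pi_stat => pi0 _ /matrixP/(_ 0 0); rewrite !mxE /= => pi1.
have [i pii] : exists i, 0 < pi i 0.
  apply/existsP; apply: contra_eqT pi1; rewrite negb_exists => /forallP pin.
  rewrite big1 => [|i _]; first by rewrite eq_sym oner_eq0.
  rewrite !mxE mulr1.
  by apply/le_anti; rewrite pi0 andbT leNgt pin.
have [n Pn] := P_irr i j.
have /rowP/(_ j) := stationary_expmx n; rewrite !mxE => <-.
rewrite (bigD1 i) //= ltr_pwDl ?sumr_ge0 //; first by rewrite !mxE mulr_gt0.
by move=> k _; rewrite !mxE mulr_ge0 // expmx_ge0.
Qed.

(* Subharmonic functions are harmonic, because [pi] is positive and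
   [pi (P a - a) = 0]. *)
Lemma subharmonic_harmonic (a : 'cV[R]_m) :
  (forall i, a i 0 <= (P *m a) i 0) -> P *m a = a.
Proof.
move=> aP; case: pi_stat => pi0 piP _.
have /matrixP/(_ 0 0) : pi^T *m (P *m a - a) = 0.
  by rewrite mulmxBr mulmxA piP subrr.
rewrite mxE [RHS]mxE => /eqP; rewrite psumr_eq0 => [|i _]; last first.
  by rewrite mxE mulr_ge0 // mxE [X in _ + X]mxE subr_ge0.
move=> /allP Pa; apply/colP => i; have /implyP/(_ isT) := Pa i (mem_index_enum _).
by rewrite mxE mulf_eq0 gt_eqF ?stationary_gt0 //= mxE [X in _ + X]mxE subr_eq0 => /eqP.
Qed.

(** If [x = Q x], then [a = |x|] satisfies [a <= Q a <= P a], so [P a = a] and every [P_ij a_j] is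
    0. Weighting by [pi] gives [pi_j a_j = 0], and irreducibility carries the zero at [j] to all
    states. *)
Lemma taboo_unitmx j : 1%:M - taboo P j \in unitmx.
Proof.
apply: unitmx_col_inj => x /eqP; rewrite mulmxBl mul1mx subr_eq0 => /eqP xQ.
pose a : 'cV[R]_m := \col_i `|x i 0|.
have aE i : a i 0 = `|x i 0| by rewrite mxE.
have a_ge0 i : 0 <= a i 0 by rewrite aE.
have aQ i : a i 0 <= (taboo P j *m a) i 0.
  rewrite aE xQ [X in `|X|]mxE mxE; apply: le_trans (ler_norm_sum _ _ _) _.
  apply: ler_sum => k _; rewrite normrM aE ler_wpM2r // ger0_norm //.
  by rewrite mxE mulrn_wge0.
have QP i : (taboo P j *m a) i 0 + P i j * a j 0 = (P *m a) i 0.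
  by rewrite taboo_mulmx mxE [X in _ + X + _]mxE [X in - X]mxE big_ord1 !mxE subrK.
have Pa : P *m a = a.
  apply: subharmonic_harmonic => i; apply: le_trans (aQ i) _.
  by rewrite -QP lerDl mulr_ge0.
have Pja i : P i j * a j 0 = 0.
  apply/le_anti; rewrite mulr_ge0 // andbT -(lerD2l ((taboo P j *m a) i 0)).
  by rewrite QP Pa addr0.
have aj0 : a j 0 = 0.
  apply/eqP; rewrite -(mulrI_eq0 _ (lregP (lt0r_neq0 (stationary_gt0 j)))).
  case: pi_stat => _ /rowP/(_ j) piPj _; move: piPj; rewrite mxE [RHS]mxE => <-.
  by rewrite mulr_suml big1 // => i _; rewrite -mulrA Pja mulr0.
have Pna n : P ^+ n *m a = a.
  elim: n => [|n IH]; first by rewrite expr0 mul1mx.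
  by rewrite exprSr -mulmxE -mulmxA Pa.
apply/colP => k; rewrite [RHS]mxE; apply/eqP; rewrite -normr_eq0 -aE.
have [n Pn] := P_irr j k.
move/colP/(_ j): (Pna n); rewrite aj0 mxE => /eqP.
rewrite psumr_eq0 => [/allP/(_ k (mem_index_enum _))/implyP/(_ isT)|l _].
  by rewrite mulf_eq0 gt_eqF.
by rewrite mulr_ge0 // expmx_ge0.
Qed.

(** The difference [w] of the two sides is left null and vanishes at [j]. Hence [w (I - Q) = (w P)_j
    e_j^T = w_j e_j^T = 0], and [I - Q] is invertible. *)
Lemma left_null_stationary (j : 'I_m) (u : 'rV[R]_m) :
  u *m (1%:M - P) = 0 -> u = (u 0 j / pi j 0) *: pi^T.
Proof.
move=> uP; case: (pi_stat) => _ piP _.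
set w := (_ *: _).
have wP : (u - w) *m (1%:M - P) = 0.
  by rewrite mulmxBl uP -scalemxAl mulmxBr mulmx1 piP subrr scaler0 subrr.
have wj : col j (u - w) = 0.
  apply/colP => i; rewrite !mxE ord1 divfK ?subrr //.
  by rewrite gt_eqF ?stationary_gt0.
have Pw : (u - w) *m P = u - w.
  by move/eqP: wP; rewrite mulmxBr mulmx1 subr_eq0 => /eqP.
apply/eqP; rewrite -subr_eq0 -[u - w](mulmxK (taboo_unitmx j)) mulmxBr mulmx1.
rewrite -[taboo P j]mulmx1 taboo_mulmx mulmx1 mulmxBr mulmxA colE mulmxA.
by rewrite Pw -!colE wj mul0mx subr0 subrr mul0mx.
Qed.
End Chain.

(** * Convergence of the series of [Q^n e] *)

Section PassageSeries.
Context (R : realType) (m : nat) (P : 'M[R]_m) (pi : 'cV[R]_m).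
Hypotheses (P_stoch : stochastic P) (P_irr : irreducible_chain P).
Hypothesis pi_stat : stationary P pi.
Variable j : 'I_m.

Let Q := taboo P j.

Let Q_ge0 i k : 0 <= Q i k.
Proof. by case: P_stoch => P0 _; rewrite mxE mulrn_wge0. Qed.

(** [Q] is nonnegative with row sums at most 1, so it does not increase the maximum norm. *)
Lemma taboo_norm_le (x : 'cV[R]_m) b :
  (forall i, `|x i 0| <= b) -> forall n i, `|(Q ^+ n *m x) i 0| <= b.
Proof.
move=> xb; elim=> [|n IH] i; first by rewrite expr0 mul1mx.
rewrite exprS -mulmxE -mulmxA mxE; apply: le_trans (ler_norm_sum _ _ _) _.
have b_ge0 : 0 <= b by apply: le_trans (xb i).
case: (P_stoch) => P0 P1; rewrite -[leRHS]mul1r -(P1 i) mulr_suml.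
apply: ler_sum => k _; rewrite normrM ler_pM // ger0_norm // mxE.
by case: (k != j); rewrite ?mulr0n ?mulr1n.
Qed.

(* With [(I - Q) y = e] the partial sums telescope to [y - Q^n y]. *)
Lemma taboo_partial_sum_bounded :
  exists c : R, forall n i, \sum_(k < n) (Q ^+ k *m ones) i 0 <= c.
Proof.
have [y yE] : exists y : 'cV[R]_m, ones = y - Q *m y.
  exists (invmx (1%:M - Q) *m ones); rewrite -[X in X - _]mul1mx -mulmxBl.
  by rewrite mulKVmx // (taboo_unitmx P_stoch P_irr pi_stat).
have yb i : `|y i 0| <= \sum_k `|y k 0|.
  by rewrite (bigD1 i) //= lerDl sumr_ge0.
(* One copy bounds [y_i], the other [(Q^n y)_i]. *)
exists (\sum_k `|y k 0| + \sum_k `|y k 0|) => n i.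
have -> : \sum_(k < n) (Q ^+ k *m ones) i 0 = y i 0 - (Q ^+ n *m y) i 0.
  elim: n => [|n IH]; first by rewrite big_ord0 expr0 mul1mx subrr.
  rewrite big_ord_recr /= IH yE mulmxBr exprSr -mulmxE mulmxA.
  have subE (A B : 'cV[R]_m) : (A - B) i 0 = A i 0 - B i 0 by rewrite !mxE.
  by rewrite subE addrA subrK.
apply: le_trans (ler_norm _) _; apply: le_trans (ler_normB _ _) _.
by rewrite lerD // taboo_norm_le.
Qed.

Lemma taboo_ones_ge0 n i : 0 <= (Q ^+ n *m ones) i 0.
Proof. by rewrite mxE sumr_ge0 // => k _; rewrite mulr_ge0 ?expmx_ge0 // mxE. Qed.

(** Bounded partial sums make the nonnegative series finite. Splitting off the term [n = 0], which
    is [e], and factoring one [Q] out of the rest gives the equation. *)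
Lemma taboo_series : exists2 s : 'cV[R]_m, s = ones + Q *m s &
  forall i, (\sum_(0 <= n <oo) ((Q ^+ n *m ones) i 0)%:E)%E = (s i 0)%:E.
Proof.
set E := fun i => (\sum_(0 <= n <oo) ((Q ^+ n *m ones) i 0)%:E)%E.
have u_ge0 n i : (0 <= ((Q ^+ n *m ones) i 0)%:E)%E.
  by rewrite lee_fin taboo_ones_ge0.
have [c Ec] := taboo_partial_sum_bounded.
have Efin i : E i \is a fin_num.
  rewrite fin_numElt (lt_le_trans (ltNy0 : (-oo < 0 :> \bar R)%E)) ?nneseries_ge0 //=.
  apply: (@le_lt_trans _ _ c%:E); last exact: ltry.
  apply: lime_le; first exact: is_cvg_nneseries.
  by apply: nearW => n; rewrite big_mkord sumEFin lee_fin.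
have Es i : E i = (fine (E i))%:E by rewrite fineK.
pose s : 'cV[R]_m := \col_i fine (E i).
have sE k : s k 0 = fine (E k) by rewrite mxE.
exists s; last by move=> i; rewrite sE -Es.
apply/colP => i; apply: EFin_inj; rewrite sE -Es.
have -> : (ones + Q *m s) i 0 = 1 + \sum_k Q i k * fine (E k).
  by rewrite mxE [in LHS]mxE; congr (_ + _); rewrite mxE; under eq_bigr do rewrite sE.
rewrite {1}/E nneseries_recl // expr0 mul1mx [ones i 0]mxE EFinD; congr (_ + _)%E.
rewrite -sumEFin -(nneseries_addn 1) //.
under eq_bigr do rewrite EFinM -Es -nneseriesZl //.
rewrite -nneseries_sum; last first.
  by move=> k n _; apply: mule_ge0 => //; rewrite lee_fin Q_ge0.
apply: eq_eseriesr => n _; rewrite addn1 exprS -mulmxE -mulmxA mxE -sumEFin.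
by apply: eq_bigr => k _; rewrite EFinM.
Qed.
End PassageSeries.

(** * Expected passage times as series of avoidance probabilities *)

Section PassageTime.
Context (R : realType) (m : nat) (P : 'M[R]_m).
Context (d : measure_display) (Omega : measurableType d).
Context (Pr : probability Omega R) (X : nat -> Omega -> 'I_m).
Local Open Scope classical_set_scope.

Definition cylinder (n : nat) (x : nat -> 'I_m) : set Omega :=
  [set w | forall k, (k <= n)%N -> X k w = x k].

(** The window starts after an arbitrary time [n] so that an induction on [N] can advance it. For
    [n = 0] this is the event [T_j > N]. *)
Definition avoids (j : 'I_m) (n N : nat) : set Omega :=
  [set w | forall k, (n < k <= n + N)%N -> X k w <> j].

(** Pointwise tail formula [T = sum_n 1[T > n]], valid also when [T] is infinite. *)
Lemma passage_time_series (j : 'I_m) (w : Omega) :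
  passage_time R X j w = (\sum_(0 <= n <oo) (\1_(avoids j 0 n) w)%:E)%E.
Proof.
have ind_ge0 n : (0 <= (\1_(avoids j 0 n) w)%:E :> \bar R)%E by rewrite lee_fin.
have ind1 n k : (forall l, (0 < l < k)%N -> X l w <> j) -> (n < k)%N ->
    \1_(avoids j 0 n) w = 1 :> R.
  move=> Xk nk; rewrite indicE mem_set // => l /andP[l0 ln].
  by apply: Xk; rewrite l0 (leq_ltn_trans ln).
have [[k [k0 Xk]]|noX] := pselect (exists k, (0 < k)%N /\ X k w = j).
  have exk : exists k, (0 < k)%N && (X k w == j) by exists k; rewrite k0 Xk eqxx.
  case: (ex_minnP exk) => k' /andP[k'0 /eqP Xk'] kmin {k k0 Xk exk}.
  move: k' k'0 Xk' kmin => k k0 Xk kmin.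
  have -> : passage_time R X j w = k%:R%:E.
    apply/le_anti/andP; split; first by apply: ereal_inf_lbound; exists k.
    apply/ereal_infP => _ [l [l0 Xl] <-].
    by rewrite lee_fin ler_nat kmin // l0 Xl eqxx.
  (* With [k] the first hitting time, the indicators are 1 for [n < k] and 0 from [n = k] on. *)
  rewrite (nneseries_split 0 k) // add0n eseries0 => [|n kn _]; last first.
    rewrite indicE memNset // => Xn; apply: (Xn k) => //.
    by rewrite k0.
  rewrite adde0 sumEFin big_mkord (eq_bigr (fun=> 1)).
    by rewrite sumr_const card_ord.
  move=> i _; apply: (ind1 i k) => // l /andP[l0 lk] Xl.
  by have := kmin l; rewrite l0 Xl eqxx leqNgt lk => /(_ isT).
have -> : passage_time R X j w = +oo%E.
  apply/eqP; rewrite -leye_eq; apply/ereal_infP => y [l Xl _].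
  by case: noX; exists l.
(* If [j] is never reached all terms are 1, so enough of them exceed any bound [A]. *)
apply/esym/eqyP => A A0; set k := Num.bound A.
apply: le_trans (nneseries_lim_ge k _) => //.
rewrite sumEFin lee_fin big_mkord (eq_bigr (fun=> 1)).
  by rewrite sumr_const card_ord ltW // archi_boundP // ltW.
move=> i _; apply: (ind1 i k) => // l /andP[l0 _] Xl.
by case: noX; exists l.
Qed.

Hypothesis X_meas : forall n s, measurable [set w | X n w = s].

Lemma measurable_cylinder n x : measurable (cylinder n x).
Proof.
exact: (bigcap_measurableType (P := [set k | (k <= n)%N])
  (F := fun k => [set w | X k w = x k])).
Qed.

Lemma measurable_avoids j n N : measurable (avoids j n N).
Proof.
apply: (bigcap_measurableType (P := [set k | (n < k <= n + N)%N])
  (F := fun k => ~` [set w | X k w = j])) => k _.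
exact: measurableC.
Qed.

Hypothesis X_markov : forall (n : nat) (x : nat -> 'I_m),
  Pr (cylinder n.+1 x) = (Pr (cylinder n x) * (P (x n) (x n.+1))%:E)%E.

(** Partition by the state [t != j] at time [n+1]: the cylinder grows by one step and the window
    shrinks by one. *)
Lemma cylinder_avoids_split j n N x :
  cylinder n x `&` avoids j n N.+1 = \big[setU/set0]_(t < m | t != j)
    (cylinder n.+1 (fun k => if k == n.+1 then t else x k)
       `&` avoids j n.+1 N).
Proof.
rewrite -bigcup_seq_cond; apply/seteqP; split=> [w [xw jw]|w].
  exists (X n.+1 w).
    rewrite /= mem_index_enum /=; apply/eqP; apply: jw.
    by rewrite ltnSn addnS ltnS leq_addr.
  split=> k.
    rewrite leq_eqVlt => /orP[/eqP -> |]; first by rewrite eqxx.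
    by rewrite ltnS => kn; rewrite ltn_eqF // xw.
  by move=> /andP[nk kN]; apply: jw; rewrite (ltnW nk) -addSnnS.
case=> t /= /andP[_ /eqP tj] [xw jw]; split=> k.
  by move=> kn; rewrite xw ?ltn_eqF // ltnW.
rewrite -addSnnS leq_eqVlt => /andP[/orP[/eqP <- _|nk kN]].
  by rewrite xw // eqxx.
by apply: jw; rewrite nk.
Qed.

(** Induction on [N] for all cylinders at once, since each step lengthens the cylinder. The product
    form also covers null cylinders. *)
Lemma cylinder_avoids_prob j N n x :
  Pr (cylinder n x `&` avoids j n N) =
  (Pr (cylinder n x) * ((taboo P j ^+ N *m ones) (x n) 0)%:E)%E.
Proof.
elim: N n x => [|N IH] n x.
  rewrite expr0 mul1mx mxE mule1 (_ : avoids j n 0 = setT) ?setIT //.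
  apply/seteqP; split=> // w _ k.
  by rewrite addn0 => /andP[nk kn]; have := leq_trans nk kn; rewrite ltnn.
rewrite cylinder_avoids_split measure_bigsetU_ord_cond; last 2 first.
- by move=> t _; apply: measurableI;
    [exact: measurable_cylinder|exact: measurable_avoids].
- apply/trivIsetP => s t _ _ /eqP st; apply/seteqP; split=> // w [[xs _] [xt _]].
  by apply: st; have := xs n.+1 (leqnn _); have := xt n.+1 (leqnn _);
    rewrite eqxx => -> ->.
(* Values of the path after time [n] do not affect the cylinder. *)
have cylE t : cylinder n (fun k => if k == n.+1 then t else x k) = cylinder n x.
  by apply/seteqP; split=> w xw k kn; have := xw k kn; rewrite ltn_eqF.
rewrite exprS -mulmxE -mulmxA mxE -sumEFin.
rewrite fin_num_sume_distrr //; last exact/fin_num_measure/measurable_cylinder.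
(* The term at [j] is 0 because column [j] of [taboo P j] is. *)
rewrite [RHS](bigD1 j) //= !mxE eqxx mulr0n mul0r mule0 add0e.
apply: eq_bigr => t tj.
by rewrite IH X_markov cylE eqxx ltn_eqF // [taboo P j _ _]mxE tj mulr1n EFinM muleA.
Qed.

(** The tail series is integrated term by term. Each avoidance event may be cut down to the start
    event, whose complement is null. *)
Lemma passage_time_expectation i j : Pr [set w | X 0%N w = i] = 1%E ->
  (\int[Pr]_w passage_time R X j w)%E =
  (\sum_(0 <= n <oo) ((taboo P j ^+ n *m ones) i 0)%:E)%E.
Proof.
move=> Pi; under eq_integral do rewrite passage_time_series.
rewrite integral_nneseries //; last first.
  move=> n; apply/measurable_realfun.measurable_EFinP.
  exact/measurable_realfun.measurable_indic/measurable_avoids.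
apply: eq_eseriesr => n _.
have mA := measurable_avoids j 0 n.
have mi := X_meas 0 i.
have iE : [set w | X 0%N w = i] = cylinder 0 (fun=> i).
  apply/seteqP; split=> [w Xi k|w]; last exact.
  by rewrite leqn0 => /eqP ->.
have Ai : Pr (avoids j 0 n `&` [set w | X 0%N w = i]) =
    ((taboo P j ^+ n *m ones) i 0)%:E.
  by rewrite setIC iE cylinder_avoids_prob -iE Pi mul1e.
rewrite integral_indic // setIT.
rewrite [LHS](measureDI Pr mA mi) [X in (_ + X)%E]Ai.
rewrite [X in (X + _)%E](_ : _ = 0%E) ?add0e //.
have Pc : Pr (~` [set w | X 0%N w = i]) = 0%E.
  by rewrite probability_setC // Pi subee.
by apply: (subset_measure0 _ _ _ Pc) => [||w []];
  [exact: measurableD|exact: measurableC|].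
Qed.
End PassageTime.

(** * Identities for mean passage times and g-inverses *)

Lemma mean_passage_recursion (R : realType) (m : nat) (P : 'M[R]_m) (pi : 'cV[R]_m)
  (d : measure_display) (Omega : measurableType d)
  (Pr : 'I_m -> probability Omega R) (X : nat -> Omega -> 'I_m) (j : 'I_m) :
  stochastic P -> irreducible_chain P -> stationary P pi ->
  (forall i, markov_chain_from P i (Pr i) X) ->
  let c := col j (mean_passage Pr X) in c = ones + taboo P j *m c.
Proof.
move=> P_stoch P_irr pi_stat X_chain c.
have [s sE Es] := taboo_series P_stoch P_irr pi_stat j.
suff -> : c = s by [].
apply/colP => i; have [X_meas X0 X_markov] := X_chain i.
by rewrite !mxE (passage_time_expectation X_meas X_markov j X0) Es.
Qed.

(** Apply [u] to [(I - P) c = e - c_j P e_j] and remove the term [k = j]; the two occurrences of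
    [(u P)_j c_j] cancel. *)
Lemma resolvent_mul_offdiag (R : realType) (m : nat) (P : 'M[R]_m) (j : 'I_m)
    (c : 'cV[R]_m) (u : 'rV[R]_m) :
  c = ones + taboo P j *m c -> u *m ones = 1%:M ->
  \sum_(k < m | k != j) (u *m (1%:M - P)) 0 k * c k 0 = 1 - u 0 j * c j 0.
Proof.
rewrite taboo_mulmx => cE u1.
have : u *m (1%:M - P) *m c = u *m ones - (u *m P) *m delta_mx j 0 *m row j c.
  rewrite -!mulmxA -mulmxBr mulmxBl mul1mx {1}cE mulmxA -colE.
  by congr (u *m _); rewrite addrA addrAC addrK.
rewrite -colE u1 => /matrixP/(_ 0 0); rewrite mxE [X in _ = X]mxE.
rewrite (bigD1 j) //= => /(canRL (addKr _)) ->.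
rewrite mulmxBr mulmx1 !mxE big_ord1 !mxE mulrBl.
by rewrite opprB [LHS]addrC addrA subrK.
Qed.

(** The rows of [(I - P) G - I] are left null for [I - P], hence multiples of [pi^T], which
    [I - e pi^T] annihilates. *)
Lemma ginverse_centered (R : realType) (m : nat) (P G : 'M[R]_m) (pi : 'cV[R]_m) :
  stochastic P -> irreducible_chain P -> stationary P pi ->
  ginverse (1%:M - P) G ->
  (1%:M - P) *m (G *m (1%:M - ones *m pi^T)) = 1%:M - ones *m pi^T.
Proof.
move=> P_stoch P_irr pi_stat G_ginv; apply/eqP; rewrite -subr_eq0 mulmxA.
rewrite -[X in _ - X]mul1mx -mulmxBl; apply/eqP/row_matrixP => i.
rewrite row_mul row0 [row i _](left_null_stationary P_stoch P_irr pi_stat i); last first.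
  by rewrite -row_mul mulmxBl mul1mx G_ginv subrr row0.
case: pi_stat => _ _ pi1.
by rewrite -scalemxAl mulmxBr mulmxA pi1 mulmx1 mul1mx subrr scaler0.
Qed.

(** [I - P + e beta^T] fixes [e], so its inverse does too, and [e pi^T] fixes [e]; the eigenvalue is
    [1 + gamma]. *)
Lemma A15a_mul_ones (R : realType) (m : nat) (P G : 'M[R]_m) (pi : 'cV[R]_m) :
  stochastic P -> stationary P pi -> in_A15a P pi G ->
  exists g : R, G *m ones = g *: ones.
Proof.
move=> P_stoch [_ _ pi1] [_ [beta [gamma [_ beta1 ->]]]]; exists (1 + gamma).
set A := 1%:M - P + _.
have A1 : A *m ones = ones.
  rewrite mulmxDl mulmxBl mul1mx (stochastic_mul_ones P_stoch) subrr add0r.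
  by rewrite -mulmxA beta1 mulmx1.
rewrite mulmxDl -scalemxAl -mulmxA pi1 mulmx1 scalerDl scale1r.
congr (_ + _); rewrite -{1}A1; case: (boolP (A \in unitmx)) => Au.
  by rewrite mulKmx.
(* For singular [A], [invmx A] is [A], which also fixes [e]. *)
by rewrite invmx_out // !A1.
Qed.

(** * Entrywise forms and the five perturbation formulas *)

Lemma sum_perturbation (R : realType) (m : nat) (A : 'M[R]_m) (u : 'cV[R]_m)
    (S : pred 'I_m) (f : 'I_m -> R) :
  \sum_(i < m) \sum_(k < m | S k) u i 0 * A i k * f k =
  \sum_(k < m | S k) (u^T *m A) 0 k * f k.
Proof.
rewrite exchange_big; apply: eq_bigr => k _.
by rewrite mxE mulr_suml; apply: eq_bigr => i _; rewrite mxE.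
Qed.

Lemma normalized_offdiag (R : realType) (m : nat) (M : 'M[R]_m) (l j : 'I_m) :
  (forall i, M i i != 0) -> l != j ->
  ((M - diag_part M) *m invmx (diag_part M)) l j = M l j / M j j.
Proof.
move=> M0 lj; set D := diag_part M.
have Du : D \in unitmx.
  by rewrite unitmxE det_diag unitfE prodf_seq_neq0; apply/allP => i _ /=;
    rewrite mxE.
have /matrixP/(_ l j) := mulmxKV Du (M - D).
rewrite mul_mx_diag !mxE (negbTE lj) mulr0n subr0 => <-.
by rewrite mulfK.
Qed.

Theorem theorem20 (R : realType) (m : nat)
  (P Pbar Eps : 'M[R]_m) (pi pibar : 'cV[R]_m) (G : 'M[R]_m)
  (d : measure_display) (Omega : measurableType d)
  (Pr : 'I_m -> probability Omega R) (X : nat -> Omega -> 'I_m)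
  (P_stoch : stochastic P) (P_irr : irreducible_chain P)
  (PbarE : Pbar = P + Eps)
  (Pbar_stoch : stochastic Pbar) (Pbar_irr : irreducible_chain Pbar)
  (pi_stat : stationary P pi) (pibar_stat : stationary Pbar pibar)
  (X_chain : forall i : 'I_m, markov_chain_from P i (Pr i) X)
  (G_ginv : ginverse (1%:M - P) G) :
  let H := G *m (1%:M - ones *m pi^T) in
  let M := mean_passage Pr X in
  let N := (M - diag_part M) *m invmx (diag_part M) in
  forall j : 'I_m,
  [/\ (* (i) *)
      pibar j 0 - pi j 0 =
        \sum_(i < m) \sum_(k < m) pibar i 0 * Eps i k * H k j,
      (* (ii) *)
      pibar j 0 - pi j 0 =
        \sum_(i < m) \sum_(k < m) pibar i 0 * Eps i k * G k j
        - pi j 0 * \sum_(i < m) \sum_(k < m)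
                     pibar i 0 * Eps i k * (\sum_(l < m) G k l),
      (* (iii) *)
      in_A15a P pi G ->
        pibar j 0 - pi j 0 =
          \sum_(i < m) \sum_(k < m) pibar i 0 * Eps i k * G k j,
      (* (iv) *)
      pi j 0 - pibar j 0 =
        pi j 0 * \sum_(i < m) \sum_(k < m | k != j)
                   pibar i 0 * Eps i k * M k j &
      (* (v) *)
      pi j 0 - pibar j 0 =
        \sum_(l < m | l != j) \sum_(k < m) pibar k 0 * Eps k l * N l j].
Proof.
move=> H M N j.
have [_ piP pi1] := pi_stat; have [_ pibarP pibar1] := pibar_stat.
set v := pibar^T *m Eps.
have vE : v = pibar^T *m (1%:M - P).
  by rewrite mulmxBr mulmx1 -{1}pibarP PbarE mulmxDr addrC addKr.
have v1 : v *m ones = 0.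
  by rewrite vE -mulmxA mulmxBl mul1mx stochastic_mul_ones // subrr mulmx0.
have vH : pibar j 0 - pi j 0 = (v *m H) 0 j.
  rewrite vE -mulmxA ginverse_centered // mulmxBr mulmxA pibar1 mulmx1 mul1mx.
  by rewrite !mxE.
have HE k : H k j = G k j - pi j 0 * (G *m ones) k 0.
  rewrite /H mulmxBr mulmx1 mulmxA mxE [X in _ + X]mxE; congr (_ - _).
  by rewrite mxE big_ord1 mulrC; congr (_ * _); rewrite mxE.
have G1 k : (G *m ones) k 0 = \sum_l G k l.
  by rewrite mxE; apply: eq_bigr => l _; rewrite mxE mulr1.
have ii : pibar j 0 - pi j 0 = \sum_k v 0 k * G k j
    - pi j 0 * \sum_k v 0 k * (G *m ones) k 0.
  rewrite vH mxE mulr_sumr -sumrB; apply: eq_bigr => k _.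
  by rewrite HE mulrBr mulrCA.
(* For [u = pi^T] the left side vanishes, which leaves the mean return time formula. *)
have pM i : pi i 0 * M i i = 1.
  have := resolvent_mul_offdiag
    (mean_passage_recursion i P_stoch P_irr pi_stat X_chain) pi1.
  rewrite big1 => [|k _]; last by rewrite mulmxBr mulmx1 piP subrr mxE mul0r.
  by rewrite [pi^T 0 i]mxE [col i _ i 0]mxE => /esym/eqP; rewrite subr_eq0 => /eqP.
(* For [u = pibar^T] the right side is [1 - pibar_j m_jj]; multiplying by [pi_j] gives the claim. *)
have iv : pi j 0 - pibar j 0 = pi j 0 * \sum_(k < m | k != j) v 0 k * M k j.
  have := resolvent_mul_offdiag
    (mean_passage_recursion j P_stoch P_irr pi_stat X_chain) pibar1.
  rewrite -vE; under eq_bigr do rewrite [col _ _ _ _]mxE.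
  move=> ->; rewrite [pibar^T 0 j]mxE [col j _ j 0]mxE mulrBr mulr1 mulrCA pM.
  by rewrite mulr1.
have M0 i : M i i != 0.
  by apply/eqP => Mi; have /eqP := pM i; rewrite Mi mulr0 eq_sym oner_eq0.
split.
- by rewrite sum_perturbation -/v vH mxE.
- rewrite !sum_perturbation -/v ii.
  by congr (_ - _ * _); apply: eq_bigr => k _; rewrite G1.
- move=> /(A15a_mul_ones P_stoch pi_stat) [g Gg].
  rewrite sum_perturbation -/v ii [X in _ - _ * X](_ : _ = 0) ?mulr0 ?subr0 //.
  (* The correction term in (ii) is [v G e = g v e], and [v e = 0]. *)
  have : v *m (G *m ones) = 0 by rewrite Gg -scalemxAr v1 scaler0.
  by move/matrixP/(_ 0 0); rewrite mxE [RHS]mxE.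
- by rewrite sum_perturbation -/v iv.
- rewrite exchange_big sum_perturbation -/v iv mulr_sumr.
  (* Here [n_kj = m_kj / m_jj = pi_j m_kj]. *)
  apply: eq_bigr => k kj; rewrite normalized_offdiag // mulrCA; congr (_ * _).
  by rewrite -[pi j 0](mulfK (M0 j)) pM mul1r mulrC.
Qed.
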